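(* Let $a,s\in\mathbb N$, and let $\gamma_a(i)$ denote the coefficients in the expansion $\{A_{a,r}\}=\sum_{i=0}^r\gamma_a(i)\,[A_{a+i,r-i}]$ of the canonical basis elements of $\mathbf S^\imath(2,a+r)$ (these coefficients do not depend on $r\ge i$). (1) If $a$ is even, then $$\gamma_a(2s)=v^{-2s^2-s}\prod_{k=1}^s\frac{1-v^{-2a-4k}}{1-v^{-4k}},\qquad\gamma_a(2s+1)=v^{-a-2s^2-3s-1}\prod_{k=1}^s\frac{1-v^{-2a-4k}}{1-v^{-4k}}.$$ (2) If $a$ is odd, then $$\gamma_a(2s)=v^{-2s^2+s}\prod_{k=1}^s\frac{1-v^{-2a-4k-2}}{1-v^{-4k}},\qquad\gamma_a(2s+1)=v^{-a-2s^2-s-1}\prod_{k=1}^s\frac{1-v^{-2a-4k-2}}{1-v^{-4k}}.$$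
   Context: $\bar v=v^{-1}$ on scalars, $\mathbb N=\{0,1,\dots\}$. For $m\in\mathbb Z,b\in\mathbb N$: $\begin{bmatrix} m \\ b \end{bmatrix}=\prod_{1\le i\le b}\frac{v^{2(m-i+1)}-1}{v^{2i}-1}$, and $\overline{\begin{bmatrix} m \\ b \end{bmatrix}}$ is obtained by $v\mapsto v^{-1}$. $\mathbf S^\imath(2,d)$ is the rank one $\imath$Schur algebra over $\mathbb Q(v)$; it has a standard basis $[A_{a,r}]$ indexed by the matrices $A_{a,r}=\begin{pmatrix} a & 0 & r \\ 0 & 1 & 0 \\ r & 0 & a \end{pmatrix}$ with $a,r\in\mathbb N$, $a+r=d$. (It is the convolution algebra of pairs of maximal isotropic subspaces of a $(2d+1)$-dimensional quadratic space over $\mathbb F_q$, $q=v^2$, $[A_{a,r}]$ being the normalized characteristic function of the set of pairs whose intersection has dimension $a$.) It also has the monomial basis $$M_{a,r}=[A_{a,r}]+\sum_{i=1}^rv^{ai-\frac{i(i+1)}2}\,\overline{\begin{bmatrix} a+i \\ i \end{bmatrix}}\,[A_{a+i,r-i}],\qquad a+r=d.$$ The bar involution on $\mathbf S^\imath(2,d)$ is the $\mathbb Q$-linear involution which is semilinear with respect to $v\mapsto v^{-1}$ and fixes every $M_{a,r}$. The canonical basis element $\{A_{a,r}\}$ is the unique bar-invariant element of the form $[A_{a,r}]+\sum_{i=1}^r\gamma_{a,r}(i)[A_{a+i,r-i}]$ with $\gamma_{a,r}(i)\in v^{-1}\mathbb Z[v^{-1}]$; one sets $\gamma_{a,r}(0)=1$.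 The $\gamma_{a,r}(i)$ are independent of $r$ and are written $\gamma_a(i)$. *)

(* Defs.v *)
From HB Require Import structures.
From mathcomp Require Import all_boot all_order all_algebra all_field.
From mathcomp Require Import generic_quotient fraction.
From mathcomp Require Import classical_sets.
Set Implicit Arguments. Unset Strict Implicit. Unset Printing Implicit Defensive.
Import GRing.Theory.
Local Open Scope ring_scope.
Local Open Scope quotient_scope.

Notation Qv := {fraction {poly rat}}.
Definition v : Qv := tofrac 'X.

Definition ratQv (c : rat) : Qv := tofrac c%:P.
Definition pbar (p : {poly rat}) : Qv := (map_poly ratQv p).[v^-1].

(* The field automorphism v |-> v^-1 of Q(v), on the chosen fraction n / d
   representing f.  It is independent of that choice: see vbar_frac. *)
Definition vbar (f : Qv) : Qv :=
  pbar \n_(repr f) / pbar \d_(repr f).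

(* f \in v^-1 Z[v^-1] *)
Definition in_vinvZ (f : Qv) : Prop :=
  exists p : {poly int}, f = v^-1 * (map_poly intr p).[v^-1].

Definition gbinom (m : int) (b : nat) : Qv :=
  \prod_(1 <= i < b.+1)
    ((v ^ (2 * (m - i%:Z + 1)) - 1) / (v ^ (2 * i%:Z) - 1)).

(* The maximal isotropic subspaces of the quadratic space F^(2d+1),
   F finite of odd characteristic, with symmetric nondegenerate Gram matrix J:
   in this dimension they are the isotropic subspaces of dimension d.
   A subspace is encoded by the canonical square matrix <<U>>%MS spanning it. *)

Definition maxiso (F : finFieldType) (d : nat) (J : 'M[F]_(d.*2.+1)) :
    {set 'M[F]_(d.*2.+1)} :=
  [set U : 'M[F]_(d.*2.+1) |
    [&& <<U>>%MS == U, \rank U == d & U *m J *m U^T == 0]].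

Definition relpos_count (F : finFieldType) (d : nat) (J : 'M[F]_(d.*2.+1))
    (a b : nat) (E G : 'M[F]_(d.*2.+1)) : nat :=
  #|[set U in maxiso J |
      (\rank (E :&: U)%MS == a) && (\rank (U :&: G)%MS == b)]|.

(* N a b c : generic structure constants of the convolution product on
   functions on pairs of maximal isotropic subspaces, with respect to the
   characteristic functions of the sets {(E, G) | dim (E :&: G) = a}. *)
Definition convolution_constants (d : nat) (N : nat -> nat -> nat -> {poly int}) :
    Prop :=
  forall (F : finFieldType) (J : 'M[F]_(d.*2.+1)),
    (2%:R : F) != 0 -> J^T = J -> J \in unitmx ->
  forall (a b c : nat), (a <= d)%N -> (b <= d)%N -> (c <= d)%N ->
  forall E G : 'M[F]_(d.*2.+1), E \in maxiso J -> G \in maxiso J ->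
    \rank (E :&: G)%MS = c ->
    (relpos_count J a b E G)%:Z = (N a b c).[#|F|%:Z].

(* Throughout, X`_a stands for [A_{a,d-a}].  For fixed E, the G with dim (E :&: G) = a form a variety of dimension
   a r + r (r + 1) / 2, where r = d - a; the standard basis element is the
   characteristic function times v to the opposite of this number. *)
Definition charfun (d : nat) (S : falgType Qv) (X : d.+1.-tuple S)
    (a : nat) : S :=
  v ^+ (a * (d - a) + (d - a) * (d - a).+1 %/ 2) *: X`_a.

(* S, with standard basis X, is the rank one iSchur algebra S^i(2,d). *)
Definition is_ischur (d : nat) (S : falgType Qv) (X : d.+1.-tuple S) : Prop :=
  basis_of fullv X /\
  exists N : nat -> nat -> nat -> {poly int},
    convolution_constants d N /\
    forall a b : nat, (a <= d)%N -> (b <= d)%N ->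
      charfun X a * charfun X b =
        \sum_(c < d.+1) (map_poly intr (N a b c)).[v ^+ 2] *: charfun X c.

Definition monomial (d : nat) (S : falgType Qv) (X : d.+1.-tuple S)
    (a r : nat) : S :=
  X`_a + \sum_(1 <= i < r.+1)
    (v ^ ((a * i)%:Z - (i * i.+1 %/ 2)%:Z) * vbar (gbinom (a + i)%:Z i))
      *: X`_(a + i).

Definition monomials (d : nat) (S : falgType Qv) (X : d.+1.-tuple S) :
    d.+1.-tuple S :=
  [tuple monomial X a (d - a) | a < d.+1].

(* The semilinear map fixing every [monomial X a (d - a)], written in the
   monomial basis (see monomials_basis, bar_semilinear, bar_monomial). *)
Definition bar (d : nat) (S : falgType Qv) (X : d.+1.-tuple S) (x : S) : S :=
  \sum_(a < d.+1) vbar (coord (monomials X) a x) *: (monomials X)`_a.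

Definition is_canonical (d : nat) (S : falgType Qv) (X : d.+1.-tuple S)
    (a r : nat) (x : S) : Prop :=
  bar X x = x /\
  exists g : nat -> Qv,
    (forall i : nat, (1 <= i <= r)%N -> in_vinvZ (g i)) /\
    x = X`_a + \sum_(1 <= i < r.+1) g i *: X`_(a + i).

(* {A_{a,r}}, for a + r = d: the element satisfying is_canonical.  The default
   value 0 is never canonical, having no leading term X`_a. *)
Definition canonical (d : nat) (S : falgType Qv) (X : d.+1.-tuple S)
    (a r : nat) : S :=
  xget 0 (fun x => is_canonical X a r x).

(* gamma_{a,r}(i), for a + r = d and i <= r *)
Definition gamma (d : nat) (S : falgType Qv) (X : d.+1.-tuple S)
    (a r i : nat) : Qv :=
  coord X (inord (a + i)) (canonical X a r).

Lemma ratQv_is_zmod_morphism : zmod_morphism ratQv.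
Proof. by move=> x y; rewrite /ratQv !raddfB. Qed.
HB.instance Definition _ :=
  GRing.isZmodMorphism.Build rat Qv ratQv ratQv_is_zmod_morphism.
Lemma ratQv_is_monoid_morphism : monoid_morphism ratQv.
Proof. by split=> [|x y]; rewrite /ratQv ?rmorph1 // !rmorphM. Qed.
HB.instance Definition _ :=
  GRing.isMonoidMorphism.Build rat Qv ratQv ratQv_is_monoid_morphism.

Lemma pbar_is_zmod_morphism : zmod_morphism pbar.
Proof. by move=> p q; rewrite /pbar rmorphB hornerD hornerN. Qed.
HB.instance Definition _ :=
  GRing.isZmodMorphism.Build {poly rat} Qv pbar pbar_is_zmod_morphism.
Lemma pbar_is_monoid_morphism : monoid_morphism pbar.
Proof.
by split=> [|p q]; rewrite /pbar ?rmorph1 ?hornerC // rmorphM hornerM.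
Qed.
HB.instance Definition _ :=
  GRing.isMonoidMorphism.Build {poly rat} Qv pbar pbar_is_monoid_morphism.

Lemma v_neq0 : v != 0.
Proof. by rewrite /v tofrac_eq0 polyX_eq0. Qed.

Lemma pbar_eq0 (p : {poly rat}) : (pbar p == 0) = (p == 0).
Proof.
apply/idP/idP=> [|/eqP->]; last by rewrite raddf0.
apply: contraLR => p0.
pose n := (size p).-1.
have szp : size p = n.+1 by rewrite /n prednK // lt0n size_poly_eq0.
have E : pbar p * v ^+ n = tofrac (\sum_(i < n.+1) p`_i *: 'X^(n - i)).
  rewrite /pbar horner_coef size_map_poly szp mulr_suml rmorph_sum.
  apply: eq_bigr => i _; rewrite coef_map -mul_polyC rmorphM rmorphXn /=.
  rewrite -mulrA -/v; congr (_ * _).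
  have le_in : (i <= n)%N by rewrite -ltnS.
  have -> : v ^+ n = v ^+ i * v ^+ (n - i) by rewrite -exprD subnKC.
  by rewrite mulrA -exprMn mulVf ?v_neq0 // expr1n mul1r.
apply/eqP => pb0; move/eqP: E; rewrite pb0 mul0r eq_sym tofrac_eq0 => /eqP/polyP/(_ 0%N).
rewrite coef0 coef_sum big_ord_recr big1 /= => [|i _].
  rewrite subnn expr0 coefZ coef1 mulr1 add0r => /eqP.
  by rewrite -[n]/((size p).-1) -lead_coefE lead_coef_eq0 (negPf p0).
by rewrite coefZ coefXn eq_sym subn_eq0 leqNgt ltn_ord mulr0.
Qed.

Lemma frac_pi (x : {ratio {poly rat}}) :
  \pi_(Qv) x * tofrac \d_x = tofrac \n_x.
Proof.
unlock FracField.tofrac; rewrite -[LHS]FracField.pi_mul.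
apply/eqmodP; rewrite /= FracField.equivfE /FracField.mulf /=.
by rewrite !numden_Ratio ?mulf_neq0 ?oner_neq0 ?denom_ratioP // !mulr1 mulrC.
Qed.

Lemma frac_repr (f : Qv) :
  f * tofrac \d_(repr f) = tofrac \n_(repr f).
Proof. by rewrite -{1}[f](reprK f) frac_pi. Qed.

Lemma vbar_frac (n d : {poly rat}) :
  d != 0 -> vbar (tofrac n / tofrac d) = pbar n / pbar d.
Proof.
move=> d0; have dF : tofrac d != 0 by rewrite tofrac_eq0.
set f : Qv := tofrac n / tofrac d; rewrite /vbar.
have := frac_repr f.
set n' := \n_ _; set d' := \d_ _.
have d'0 : d' != 0 by exact: denom_ratioP.
move=> E; have {}E : n * d' = n' * d.
  apply/eqP; rewrite -tofrac_eq !rmorphM /= -E; apply/eqP.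
  by rewrite mulrAC /f divfK.
apply/eqP; rewrite eqr_div ?pbar_eq0 //.
by rewrite -!rmorphM /= E mulrC.
Qed.

Lemma QvP (f : Qv) :
  exists n d : {poly rat}, d != 0 /\ f = tofrac n / tofrac d.
Proof.
exists \n_(repr f), \d_(repr f).
split; first exact: denom_ratioP.
by rewrite -frac_repr mulfK // tofrac_eq0 denom_ratioP.
Qed.

Lemma vbar_tofrac (n : {poly rat}) : vbar (tofrac n) = pbar n.
Proof.
have := @vbar_frac n 1 (oner_neq0 _).
by rewrite !rmorph1 !divr1.
Qed.

Lemma vbar_is_zmod_morphism : zmod_morphism vbar.
Proof.
move=> x y; have [n [d [d0 ->]]] := QvP x; have [m [e [e0 ->]]] := QvP y.
have E : tofrac n / tofrac d - tofrac m / tofrac e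
  = tofrac (n * e - m * d) / tofrac (d * e) :> Qv.
  rewrite !(rmorphB, rmorphM) /= -[in LHS]mulNr addf_div ?tofrac_eq0 //.
  by rewrite mulNr.
rewrite E !vbar_frac ?mulf_neq0 //.
by rewrite !(rmorphB, rmorphM) /= -[in RHS]mulNr addf_div ?pbar_eq0 // mulNr.
Qed.
HB.instance Definition _ :=
  GRing.isZmodMorphism.Build Qv Qv vbar vbar_is_zmod_morphism.

Lemma vbar_is_monoid_morphism : monoid_morphism vbar.
Proof.
split=> [|x y]; first by rewrite -(tofrac1 {poly rat}) vbar_tofrac rmorph1.
have [n [d [d0 ->]]] := QvP x; have [m [e [e0 ->]]] := QvP y.
rewrite mulf_div -!rmorphM !vbar_frac ?mulf_neq0 //.
by rewrite mulf_div -!rmorphM.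
Qed.
HB.instance Definition _ :=
  GRing.isMonoidMorphism.Build Qv Qv vbar vbar_is_monoid_morphism.

Lemma vbar_v : vbar v = v^-1.
Proof. by rewrite vbar_tofrac /pbar map_polyX hornerX. Qed.

Lemma vbar_pbar (p : {poly rat}) : vbar (pbar p) = tofrac p.
Proof.
rewrite {1}/pbar horner_coef rmorph_sum size_map_poly.
rewrite -[in RHS](coefK p) poly_def rmorph_sum /=; apply: eq_bigr => i _.
rewrite coef_map rmorphM rmorphXn fmorphV /= vbar_v invrK.
by rewrite vbar_tofrac /pbar map_polyC hornerC -mul_polyC rmorphM rmorphXn.
Qed.

Lemma vbarK : involutive vbar.
Proof.
move=> f; have [n [d [d0 ->]]] := QvP f.
by rewrite vbar_frac // fmorph_div /= !vbar_pbar.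
Qed.

Lemma monomials_basis (d : nat) (S : falgType Qv) (X : d.+1.-tuple S) :
  basis_of fullv X -> basis_of fullv (monomials X).
Proof.
move=> bX; have le_dim : (size (monomials X) <= \dim {:S})%N.
  by rewrite size_tuple -(size_basis bX).
rewrite basisEdim le_dim andbT.
suff H a : (a <= d)%N -> X`_a \in <<monomials X>>%VS.
  rewrite -(span_basis bX); apply/span_subvP => x /(nthP 0) [i].
  by rewrite size_tuple ltnS => /H Hi <-.
have [k] := ubnP (d - a); elim: k a => // k IH a; rewrite ltnS => ak ad.
have mem : monomial X a (d - a) \in <<monomials X>>%VS.
  apply: memv_span; have lt : (a < d.+1)%N by [].
  by have := mem_tnth (Ordinal lt) (monomials X); rewrite tnth_mktuple.
rewrite -[X`_a](addrK (\sum_(1 <= i < (d - a).+1)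
    (v ^ ((a * i)%:Z - (i * i.+1 %/ 2)%:Z) * vbar (gbinom (a + i)%:Z i))
      *: X`_(a + i))).
apply: rpredB => //; rewrite big_nat; apply: rpred_sum => i /andP [i1 id].
apply: rpredZ; apply: IH; last by rewrite -leq_subRL.
have lt : (0 < d - a)%N by apply: leq_trans i1 _.
by apply: leq_trans ak; rewrite subnDA ltn_subrL i1.
Qed.

Lemma bar_is_zmod_morphism (d : nat) (S : falgType Qv) (X : d.+1.-tuple S) :
  zmod_morphism (bar X).
Proof.
move=> x y; rewrite /bar -sumrB; apply: eq_bigr => a _.
by rewrite raddfB /= rmorphB /= scalerBl.
Qed.

Lemma bar_semilinear (d : nat) (S : falgType Qv) (X : d.+1.-tuple S)
    (c : Qv) (x : S) : bar X (c *: x) = vbar c *: bar X x.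
Proof.
rewrite /bar scaler_sumr; apply: eq_bigr => a _.
by rewrite linearZ /= rmorphM /= scalerA.
Qed.

Lemma nth_monomials (d : nat) (S : falgType Qv) (X : d.+1.-tuple S) (a : nat) :
  (a <= d)%N -> (monomials X)`_a = monomial X a (d - a).
Proof.
move=> ad; have lt : (a < d.+1)%N by [].
by rewrite -[a]/(val (Ordinal lt)) -tnth_nth tnth_mktuple.
Qed.

Lemma bar_monomial (d : nat) (S : falgType Qv) (X : d.+1.-tuple S) (a : nat) :
  basis_of fullv X -> (a <= d)%N ->
  bar X (monomial X a (d - a)) = monomial X a (d - a).
Proof.
move=> bX ad; have bM := monomials_basis bX.
have lt : (a < d.+1)%N by [].
pose o := Ordinal lt.
have cM i : coord (monomials X) i (monomials X)`_a = (i == o)%:R.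
  by rewrite (coord_free o i (basis_free bM)) eq_sym.
rewrite -(nth_monomials X ad) /bar (bigD1 o) //= big1 => [|i /negPf io].
  by rewrite cM eqxx rmorph1 scale1r addr0.
by rewrite cM io rmorph0 scale0r.
Qed.

Lemma bar_involutive (d : nat) (S : falgType Qv) (X : d.+1.-tuple S) :
  basis_of fullv X -> involutive (bar X).
Proof.
move=> bX x; have bM := monomials_basis bX.
rewrite [RHS](coord_basis bM (memvf x)) [bar X x in LHS]/bar.
pose barA := GRing.isZmodMorphism.Build S S (bar X) (bar_is_zmod_morphism X).
pose f : {additive S -> S} := HB.pack (bar X) barA.
rewrite -[bar X _]/(f _) raddf_sum; apply: eq_bigr => a _.
rewrite /f /= bar_semilinear vbarK; congr (_ *: _).
have ad : (a <= d)%N by rewrite -ltnS.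
by rewrite nth_monomials // bar_monomial.
Qed.

(* Main.v *)
(** Put q = v^2 and let kap m be the product of the v^-k - v^k for 1 <= k <= m.
    In the rescaled basis Y_m = kap m [A_{m,d-m}] the coefficients of the
    monomials depend only on the difference of the indices; writing t for the
    shift of the index by 1, (kap a) M_a is Y_a shifted by 1/(t;q)_oo, and bar
    invariance of the monomials becomes
      bar Y_a = (-1)^a (1 + t)/(t^2;q^2)_oo Y_a.
    The claimed element is therefore bar invariant if and only if
      sum_{i <= n} bar(gamma_a(i)) / kap (a+i) * 1/(q^2;q^2)_{(n-i)/2}
        = gamma_a(n) / kap (a+n),
    with (n-i)/2 rounded down.  Pairing the terms i = 2j and i = 2j+1 reduces
    this to the finite Durfee square identity.  Uniqueness holds because bar is
    unitriangular in the standard basis and 0 is the only bar invariant scalar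
    in v^-1 Z[v^-1]. *)
Require Import Defs.
From mathcomp Require Import all_boot all_order all_algebra all_field.
From mathcomp Require Import ring zify.
Set Implicit Arguments. Unset Strict Implicit. Unset Printing Implicit Defensive.
Import GRing.Theory.
Local Open Scope ring_scope.

(** * q-Pochhammer symbols and the finite Durfee square identity *)

Definition qpoch (F : fieldType) (Q z : F) (n : nat) : F :=
  \prod_(k < n) (1 - z * Q ^+ k).

Lemma qpoch0 (F : fieldType) (Q z : F) : qpoch Q z 0 = 1.
Proof. exact: big_ord0. Qed.

Lemma qpochS (F : fieldType) (Q z : F) n :
  qpoch Q z n.+1 = qpoch Q z n * (1 - z * Q ^+ n).
Proof. exact: big_ord_recr. Qed.

Lemma qpochSl (F : fieldType) (Q z : F) n :
  qpoch Q z n.+1 = (1 - z) * qpoch Q (z * Q) n.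
Proof.
rewrite /qpoch big_ord_recl expr0 mulr1; congr (_ * _).
by apply: eq_bigr => i _; rewrite -mulrA -exprS.
Qed.

Lemma qpoch_neq0 (F : fieldType) (Q z : F) n :
  (forall k, z * Q ^+ k != 1) -> qpoch Q z n != 0.
Proof.
by move=> zQ; apply/prodf_neq0 => i _; rewrite subr_eq0 eq_sym zQ.
Qed.

(* Splitting 1 - Q^(m+1) as (1 - Q^j) + Q^j (1 - Q^(m+1-j)) in the j-th term
   turns the sum for (m+1, z) into the one for (m, z Q). *)
Lemma durfee_sum (F : fieldType) (Q z : F) (m : nat) :
  (forall k, Q ^+ k.+1 != 1) -> (forall k, z * Q ^+ k.+1 != 1) ->
  \sum_(j < m.+1) z ^+ j * Q ^+ (j ^ 2) /
      (qpoch Q Q (m - j) * qpoch Q Q j * qpoch Q (z * Q) j) =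
    (qpoch Q Q m * qpoch Q (z * Q) m)^-1.
Proof.
move=> hQ; elim: m z => [|m IH] z hz.
  by rewrite big_ord1 subnn !qpoch0 exp0n // !expr0 !mulr1 mul1r.
have hQ' k : Q * Q ^+ k != 1 by rewrite -exprS.
have hz' k : z * Q * Q ^+ k != 1 by rewrite -mulrA -exprS.
have hzz k : z * Q * Q ^+ k.+1 != 1 by rewrite -mulrA -exprS.
have nz0 : 1 - z * Q != 0 by have := hz' 0; rewrite subr_eq0 eq_sym mulr1.
have nQ k : 1 - Q * Q ^+ k != 0 by rewrite subr_eq0 eq_sym.
have nz k : 1 - z * Q * Q ^+ k != 0 by rewrite subr_eq0 eq_sym.
have pQ k : qpoch Q Q k != 0 by exact: qpoch_neq0.
have pz k : qpoch Q (z * Q) k != 0 by exact: qpoch_neq0.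
have pzz k : qpoch Q (z * Q * Q) k != 0.
  by apply: qpoch_neq0 => i; rewrite -[z * Q * Q * _]mulrA -exprS.
pose t j := z ^+ j * Q ^+ (j ^ 2) /
      (qpoch Q Q (m.+1 - j) * qpoch Q Q j * qpoch Q (z * Q) j).
apply: (mulfI (nQ m)).
transitivity (\sum_(j < m.+2) (1 - Q ^+ j) * t j +
              \sum_(j < m.+2) Q ^+ j * (1 - Q ^+ (m.+1 - j)) * t j).
  rewrite -big_split mulr_sumr; apply: eq_bigr => -[j ltj] _ /=.
  rewrite -mulrDl /t; congr (_ * _).
  have -> : Q * Q ^+ m = Q ^+ j * Q ^+ (m.+1 - j).
    by rewrite -exprS -exprD subnKC.
  by ring.
(* The first sum loses its term j = 0 and the second its term j = m+1; shifting the index of the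
   first puts both over the same m+1 indices. *)
rewrite big_ord_recl expr0 subrr mul0r add0r.
rewrite [X in _ + X]big_ord_recr /= subnn expr0 subrr mulr0 mul0r addr0.
rewrite -big_split /= qpochS qpochSl.
have := IH _ hzz; move/(congr1 (fun y => y / (1 - z * Q))).
rewrite mulr_suml => E; transitivity (((qpoch Q Q m * qpoch Q (z * Q * Q) m)^-1) /
  (1 - z * Q)); last by field; rewrite pQ nQ pzz nz0.
rewrite -{}E; apply: eq_bigr => -[j ltj] _ /=.
rewrite /t /bump /= add1n subSS subSn // !qpochS.
have -> : qpoch Q (z * Q * Q) j =
    qpoch Q (z * Q) j * (1 - z * Q * Q ^+ j) / (1 - z * Q).
  by rewrite -qpochS qpochSl [RHS]mulrAC divff ?mul1r.
have -> : (j.+1 ^ 2 = j ^ 2 + j.*2.+1)%N by rewrite -!mulnn; lia.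
rewrite exprMn !exprD !exprS -addnn exprD.
have := nQ (m - j)%N; have := nQ j; have := nz j; have := pz j.
have := pQ j; have := pQ (m - j)%N.
move: (qpoch Q Q (m - j)) (qpoch Q Q j) (qpoch Q (z * Q) j).
move: (Q ^+ (m - j)) (Q ^+ j) (Q ^+ (j ^ 2)) (z ^+ j) => q1 q2 q3 q4 p1 p2 p3 *.
by field; do ![apply/andP; split].
Qed.

(** * Rescaling factors and the candidate coefficients *)

Definition kap (F : fieldType) (x : F) (m : nat) : F :=
  \prod_(k < m) (x ^- k.+1 - x ^+ k.+1).

Lemma kap0 (F : fieldType) (x : F) : kap x 0 = 1.
Proof. exact: big_ord0. Qed.

Lemma kapS (F : fieldType) (x : F) m :
  kap x m.+1 = kap x m * (x ^- m.+1 - x ^+ m.+1).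
Proof. exact: big_ord_recr. Qed.

Lemma kap_neq0 (F : fieldType) (x : F) m :
  x != 0 -> (forall k, x ^+ k.+1 != 1) -> kap x m != 0.
Proof.
move=> x0 hx; apply/prodf_neq0 => i _.
have xi : x ^+ i.+1 != 0 by rewrite expf_neq0.
rewrite subr_eq0 -(inj_eq (mulfI xi)) mulfV // -expr2 -exprM eq_sym muln2.
exact: hx.
Qed.

(* The Gaussian binomial [b + s choose s] in the variable Q. *)
Definition qbin (F : fieldType) (Q : F) (b s : nat) : F :=
  \prod_(k < s) ((1 - Q ^+ (b + k.+1)) / (1 - Q ^+ k.+1)).

Lemma qbin0 (F : fieldType) (Q : F) b : qbin Q b 0 = 1.
Proof. exact: big_ord0. Qed.

Lemma qbinS (F : fieldType) (Q : F) b s :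
  qbin Q b s.+1 = qbin Q b s * ((1 - Q ^+ (b + s.+1)) / (1 - Q ^+ s.+1)).
Proof. exact: big_ord_recr. Qed.

(** One formula for four exponents: with s = n/2 rounded down, the binomial is 2s^2+s for even a and
    2s^2-s for odd a; an odd n adds a+n. *)
Definition gamma_exp (a n : nat) : nat :=
  'C(n./2.*2 + ~~ odd a, 2) + odd n * (a + n).

(* gamma_coef v^-1 a n is gamma_a(n), and gamma_coef v a n its bar conjugate. *)
Definition gamma_coef (F : fieldType) (x : F) (a n : nat) : F :=
  x ^+ gamma_exp a n * qbin (x ^+ 4) (uphalf a) n./2.

Lemma gamma_coef0 (F : fieldType) (x : F) a : gamma_coef x a 0 = 1.
Proof.
by rewrite /gamma_coef /gamma_exp /= qbin0 mulr1 addn0; case: odd.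
Qed.

Lemma gamma_exp_odd a s :
  gamma_exp a s.*2.+1 = (gamma_exp a s.*2 + (a + s.*2.+1))%N.
Proof.
by rewrite /gamma_exp /= uphalf_double odd_double doubleK mul0n addn0 mul1n.
Qed.

Lemma gamma_coef_odd (F : fieldType) (x : F) a s :
  gamma_coef x a s.*2.+1 = x ^+ (a + s.*2.+1) * gamma_coef x a s.*2.
Proof.
rewrite /gamma_coef gamma_exp_odd exprD /= uphalf_double doubleK.
by rewrite mulrA [_ ^+ _ * _]mulrC.
Qed.

Lemma gamma_exp_doubleS a s :
  gamma_exp a s.+1.*2 = (gamma_exp a s.*2 + (4 * s + 1 + (~~ odd a).*2))%N.
Proof.
rewrite /gamma_exp !odd_double !doubleK !mul0n !addn0 doubleS.
case: (~~ odd a); rewrite /= ?addn0 ?addn1 !binS !bin1 ?bin0; lia.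
Qed.

Lemma gamma_coef_doubleS (F : fieldType) (x : F) a s :
  gamma_coef x a s.+1.*2 = gamma_coef x a s.*2 *
    (x ^+ (4 * s + 1 + (~~ odd a).*2) *
    ((1 - x ^+ (4 * (uphalf a + s.+1))) / (1 - x ^+ (4 * s.+1)))).
Proof.
rewrite /gamma_coef gamma_exp_doubleS exprD !doubleK qbinS -!exprM.
by rewrite mulrACA.
Qed.

(** * The convolution identity behind bar invariance *)

Section Gamma.

Variables (F : fieldType) (x : F) (a : nat).
Hypotheses (x0 : x != 0) (hx : forall k, x ^+ k.+1 != 1).

Let Q := x ^+ 4.
Let A := x ^+ (a.+1).*2.
(** Chosen so that [gamma_coef x] and [gamma_coef x^-1] at 2s differ by the factor z^s Q^(s^2), the
    numerator of a Durfee summand; this makes z equal to A for even a and to A/x^2 for odd a. *)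
Let z := x ^+ (a + ~~ odd a).*2.

(** [T j] over (Q;Q)_(m-j) is the Durfee summand, and [D m] is the value of the sum. *)
Let D s : F := (qpoch Q Q s * qpoch Q (z * Q) s)^-1.
Let T s : F := z ^+ s * Q ^+ (s ^ 2) * D s.

Let xn1 n : (0 < n)%N -> 1 - x ^+ n != 0.
Proof. by case: n => // n _; rewrite subr_eq0 eq_sym hx. Qed.

Let D_S s : D s.+1 = D s / ((1 - Q * Q ^+ s) * (1 - z * Q * Q ^+ s)).
Proof. by rewrite /D !qpochS -invfM mulrACA. Qed.

Let T_S s : T s.+1 =
  T s * (z * Q ^+ (2 * s).+1 / ((1 - Q * Q ^+ s) * (1 - z * Q * Q ^+ s))).
Proof.
rewrite /T D_S exprSr.
have -> : (s.+1 ^ 2 = s ^ 2 + (2 * s).+1)%N by rewrite -!mulnn; lia.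
by rewrite exprD [RHS]mulrACA; congr (_ * _); exact: mulrACA.
Qed.

Lemma gamma_coef_closed s :
  (1 - A) * kap x a * gamma_coef x a s.*2 =
  (1 - A * Q ^+ s) * T s * kap x (a + s.*2).
Proof.
elim: s => [|s IH].
  rewrite gamma_coef0 /T /D exp0n // !qpoch0 // !expr0 addn0.
  by rewrite !(mulr1, invr1).
rewrite [in RHS]doubleS !addnS !kapS gamma_coef_doubleS T_S [LHS]mulrA {}IH.
move: (T s) (kap x (a + s.*2)) => t K.
(* Every power that occurs is a monomial in x, y and w, and the parity of a enters only through c,
   so the induction step becomes two rational identities. *)
pose y := x ^+ (a + s.*2); pose w := x ^+ s.
have y0 : y != 0 by rewrite expf_neq0.
have w0 : w != 0 by rewrite expf_neq0.
have a2 := odd_double_half a.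
have eA : A * Q ^+ s = (y * x) ^+ 2.
  by rewrite /A /Q /y -exprSr -!exprM -exprD; congr (x ^+ _); lia.
have eAS : A * Q ^+ s.+1 = y ^+ 2 * x ^+ 6.
  by rewrite /A /Q /y -!exprM -!exprD; congr (x ^+ _); lia.
have eQ : Q * Q ^+ s = x ^+ 4 * w ^+ 4.
  by rewrite /Q /w -!exprM -!exprD; congr (x ^+ _); lia.
have ey1 : x ^+ (a + s.*2).+1 = y * x by rewrite exprSr.
have ey2 : x ^+ (a + s.*2).+2 = y * x ^+ 2 by rewrite /y -exprD addn2.
have eM : x ^+ (4 * s.+1) = x ^+ 4 * w ^+ 4 by rewrite mulnS exprD mulnC exprM.
have n1 : 1 - x ^+ 4 * w ^+ 4 != 0 by rewrite -eM xn1.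
have n2 : 1 - y ^+ 2 * x ^+ 4 != 0 by rewrite /y -exprM -exprD xn1 // addnC.
have n3 : 1 - y ^+ 2 * x ^+ 6 != 0 by rewrite /y -exprM -exprD xn1 // addnC.
rewrite eA eAS eQ ey1 ey2 eM {eA eAS eQ ey1 ey2 eM}.
pose c := ~~ odd a.
have eE : x ^+ (4 * s + 1 + c.*2) = w ^+ 4 * x ^+ (1 + c.*2).
  by rewrite -addnA exprD mulnC exprM.
have ez : z * Q * Q ^+ s = y ^+ 2 * x ^+ (4 + c.*2).
  by rewrite /z /Q /y -!exprM -!exprD; congr (x ^+ _); lia.
have ez' : z * Q ^+ (2 * s).+1 = y ^+ 2 * x ^+ (4 + c.*2) * w ^+ 4.
  by rewrite /z /Q /y /w -!exprM -!exprD; congr (x ^+ _); lia.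
have eN : x ^+ (4 * (uphalf a + s.+1)) = y ^+ 2 * x ^+ (6 - c.*2).
  rewrite uphalf_half /y -!exprM -!exprD; congr (x ^+ _); rewrite /c.
  by lia.
rewrite eE ez ez' eN {eE ez ez' eN}.
by case: c; rewrite [_.*2]/= ?addn0; field; rewrite exprMn; apply/and4P.
Qed.

Lemma gamma_coefV_double s :
  gamma_coef x^-1 a s.*2 * (z ^+ s * Q ^+ (s ^ 2)) = gamma_coef x a s.*2.
Proof.
elim: s => [|s IH]; first by rewrite !gamma_coef0 exp0n // !expr0 !mulr1.
rewrite !gamma_coef_doubleS exprSr !exprVn -{}IH.
have -> : (s.+1 ^ 2 = s ^ 2 + (2 * s).+1)%N by rewrite -!mulnn; lia.
rewrite [Q ^+ (_ + _)]exprD [z ^+ s * z * _]mulrACA [LHS]mulrACA; congr (_ * _).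
set E := (4 * s + 1 + _)%N; set N := (4 * (_ + _))%N; set M := (4 * s.+1)%N.
have n1 : 1 - x ^+ M != 0 by rewrite xn1.
have n0 k : x ^+ k != 0 by rewrite expf_neq0.
suff -> : z * Q ^+ (2 * s).+1 = x ^+ E ^+ 2 * x ^+ N / x ^+ M.
  move: (n0 E) (n0 N) (n0 M) n1.
  move: (x ^+ E) (x ^+ N) (x ^+ M) => e n m *; field.
  by rewrite -(opprB 1) oppr_eq0; apply/and5P.
apply: (mulIf (n0 M)); rewrite mulfVK ?n0 // /z /Q /E /N /M uphalf_half.
have a2 := odd_double_half a.
by rewrite -!exprM -!exprD; congr (x ^+ _); case: odd a2 => /= a2; lia.
Qed.

Lemma gamma_coefV_closed s :
  (1 - A) * kap x a * gamma_coef x^-1 a s.*2 =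
  (1 - A * Q ^+ s) * D s * kap x (a + s.*2).
Proof.
have nz : z ^+ s * Q ^+ (s ^ 2) != 0 by rewrite mulf_neq0 ?expf_neq0.
apply: (mulIf nz); rewrite -[LHS]mulrA gamma_coefV_double gamma_coef_closed /T.
move: (D s) (kap _ _) (z ^+ s) (Q ^+ (s ^ 2)) (1 - A * _) => *.
by field.
Qed.

Let xz k : z * Q ^+ k.+1 != 1.
Proof. by rewrite -exprM mulnS -exprD addnCA hx. Qed.

Let xQ k : Q ^+ k.+1 != 1.
Proof. by rewrite -exprM mulnS hx. Qed.

(** Up to the constant (1 - A) kap a, [h] and [g] are [gamma_coef x a n] and [gamma_coef x^-1 a n]
    divided by kap (a+n). The point is that h(2j) + h(2j+1) = T j. *)
Let h n : F := if odd n then A * Q ^+ n./2 * T n./2 else (1 - A * Q ^+ n./2) * T n./2.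
Let g n : F := if odd n then D n./2 else (1 - A * Q ^+ n./2) * D n./2.

Let AQ s : A * Q ^+ s = x ^+ (a + s.*2).+1 ^+ 2.
Proof. by rewrite -!exprM -exprD; congr (x ^+ _); lia. Qed.

Let gamma_h n : (1 - A) * kap x a * gamma_coef x a n = h n * kap x (a + n).
Proof.
rewrite /h -[n]odd_double_half halfD; case: (odd n); rewrite /= odd_double doubleK.
  rewrite add0n add1n gamma_coef_odd mulrCA gamma_coef_closed addnS kapS AQ.
  have : x ^+ (a + n./2.*2).+1 != 0 by rewrite expf_neq0.
  move: (x ^+ _.+1) (T _) => y t y0 /=; field.
  exact: y0.
by rewrite !add0n gamma_coef_closed.
Qed.

Let gammaV_g n : (1 - A) * kap x a * gamma_coef x^-1 a n = g n * kap x (a + n).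
Proof.
rewrite /g -[n]odd_double_half halfD; case: (odd n); rewrite /= odd_double doubleK.
  rewrite add0n add1n gamma_coef_odd mulrCA gamma_coefV_closed addnS kapS AQ exprVn.
  have : x ^+ (a + n./2.*2).+1 != 0 by rewrite expf_neq0.
  move: (x ^+ _.+1) (D _) => y t y0 /=; field.
  exact: y0.
by rewrite !add0n gamma_coefV_closed.
Qed.

Let sum_T m : \sum_(j < m.+1) T j / qpoch Q Q (m - j) = D m.
Proof.
rewrite [RHS]/D -(durfee_sum m xQ xz); apply: eq_bigr => j _.
by rewrite /T /D -[LHS]mulrA -invfM -[qpoch Q Q (m - j) * _ * _]mulrA [X in X^-1]mulrC.
Qed.

Lemma sum_double_ord (f : nat -> F) m :
  \sum_(i < m.*2) f i = \sum_(j < m) (f j.*2 + f j.*2.+1).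
Proof.
elim: m => [|m IH]; first by rewrite !big_ord0.
by rewrite doubleS !big_ord_recr /= IH addrA.
Qed.

(** The indices 2j and 2j+1 carry the same weight 1/(Q;Q)_(m-j), so each pair contributes a full
    Durfee summand. *)
Let conv_odd m :
  \sum_(i < m.*2.+2) h i / qpoch Q Q (m.*2.+1 - i)./2 = g m.*2.+1.
Proof.
rewrite -doubleS (sum_double_ord (fun i => h i / qpoch Q Q (m.*2.+1 - i)./2)).
rewrite /g /= odd_double uphalf_double -sum_T; apply: eq_bigr => -[j ltj] _ /=.
have -> : (m.*2.+1 - j.*2)./2 = (m - j)%N by lia.
have -> : (m.*2.+1 - j.*2.+1)./2 = (m - j)%N by lia.
rewrite /h /= odd_double /= uphalf_double doubleK -mulrDl; congr (_ / _).
by rewrite -mulrDl subrK mul1r.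
Qed.

(** Here the weights of 2j and 2j+1 are 1/(Q;Q)_(m-j) and 1/(Q;Q)_(m-j-1). A pair contributes (1 - A
    Q^m) T j / (Q;Q)_(m-j), whose first factor is independent of j; the unpaired index 2m has the
    same form. *)
Let conv_even m :
  \sum_(i < m.*2.+1) h i / qpoch Q Q (m.*2 - i)./2 = g m.*2.
Proof.
rewrite big_ord_recr /=.
rewrite (sum_double_ord (fun i => h i / qpoch Q Q (m.*2 - i)./2)).
rewrite /g odd_double doubleK -sum_T [in RHS]big_ord_recr mulrDr /=.
rewrite /h odd_double doubleK !subnn; congr (_ + _); last by rewrite /T !mulrA.
rewrite mulr_sumr; apply: eq_bigr => -[j ltj] _ /=.
rewrite odd_double doubleK uphalf_double /=.
have -> : (m.*2 - j.*2)./2 = (m - j.+1).+1 by lia.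
have -> : (m.*2 - j.*2.+1)./2 = (m - j.+1)%N by lia.
have -> : (m - j = (m - j.+1).+1)%N by lia.
rewrite qpochS.
have -> : A * Q ^+ m = A * Q ^+ j * (Q * Q ^+ (m - j.+1)).
  by rewrite -exprS -mulrA -exprD; congr (_ * _ ^+ _); lia.
have : qpoch Q Q (m - j.+1) != 0.
  by apply: qpoch_neq0 => k; rewrite -exprS.
have : 1 - Q * Q ^+ (m - j.+1) != 0 by rewrite -exprS subr_eq0 eq_sym.
move: (Q * _) (qpoch _ _ _) (T j) (A * _) => y p t b *.
by field; apply/andP.
Qed.

(** For x = v this is bar invariance of the candidate; its case a = 0 also factors the coefficients
    of the monomials. *)
Lemma gamma_coef_conv n :
  \sum_(i < n.+1) gamma_coef x a i / kap x (a + i) / qpoch Q Q (n - i)./2 =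
  gamma_coef x^-1 a n / kap x (a + n).
Proof.
have nk m : kap x m != 0 by exact: kap_neq0.
have n0 : (1 - A) * kap x a != 0 by rewrite mulf_neq0 // xn1 // doubleS.
apply: (mulfI n0); rewrite [RHS]mulrA gammaV_g mulfK // mulr_sumr.
transitivity (\sum_(i < n.+1) h i / qpoch Q Q (n - i)./2).
  by apply: eq_bigr => i _; rewrite 2!mulrA gamma_h mulfK.
rewrite -[n]odd_double_half; case: (odd n); first exact: conv_odd.
exact: conv_even.
Qed.

End Gamma.


(** * Scalars in Q(v) and the coefficients of the monomials *)

Lemma v_expn_neq1 k : v ^+ k.+1 != 1.
Proof.
rewrite /v -rmorphXn -(rmorph1 (@tofrac _)) tofrac_eq.
by apply/eqP => /(congr1 (fun p : {poly rat} => size p)); rewrite size_polyXn size_poly1.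
Qed.

Lemma vbar_kap m : vbar (kap v m) = (-1) ^+ m * kap v m.
Proof.
elim: m => [|m IH]; first by rewrite kap0 rmorph1 mulr1.
rewrite kapS rmorphM /= IH rmorphB fmorphV rmorphXn /= vbar_v exprVn invrK.
by rewrite -opprB mulrN [(-1) ^+ m.+1]exprS mulN1r !mulNr mulrA.
Qed.

Lemma vbar_gamma_coef a n : vbar (gamma_coef v^-1 a n) = gamma_coef v a n.
Proof.
rewrite /gamma_coef rmorphM rmorphXn fmorphV /= vbar_v invrK; congr (_ * _).
rewrite rmorph_prod; apply: eq_bigr => i _.
by rewrite fmorph_div /= !(rmorphB, rmorph1, rmorphXn) /= fmorphV /= vbar_v invrK.
Qed.

Lemma kapD (F : fieldType) (x : F) a n :
  kap x (a + n) = kap x a * \prod_(k < n) (x ^- (a + k.+1) - x ^+ (a + k.+1)).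
Proof.
by elim: n => [|n IH]; rewrite ?addn0 ?big_ord0 ?mulr1 // addnS kapS IH big_ord_recr mulrA -addnS.
Qed.

(** At a = 0 the Gaussian binomial is trivial and both parities of n give n(n+1)/2, the exponent
    occurring in the monomial basis. *)
Lemma gamma_coef_0l (F : fieldType) (x : F) n :
  (forall k, x ^+ k.+1 != 1) -> gamma_coef x 0 n = x ^+ 'C(n.+1, 2).
Proof.
move=> hx; rewrite /gamma_coef /qbin big1 => [|i _]; last first.
  by rewrite divff // -exprM mulnS subr_eq0 eq_sym hx.
rewrite mulr1 /gamma_exp add0n addn1; congr (_ ^+ _).
move: (odd_double_half n); move: (n./2.*2) (odd n) => m [] <-.
  by rewrite add1n mul1n [RHS]binS bin1.
by rewrite addn0.
Qed.

Lemma vV_expn_neq1 k : v^-1 ^+ k.+1 != 1.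
Proof. by rewrite exprVn invr_eq1 v_expn_neq1. Qed.

(** Since v^(-2m) - 1 = v^-m (v^-m - v^m), the conjugate Gaussian binomial is v^(-ai) kap (a+i) /
    (kap a kap i), and v^(ai) cancels. *)
Lemma monomial_coefE a i :
  v ^ ((a * i)%:Z - (i * i.+1 %/ 2)%:Z) * vbar (gbinom (a + i)%:Z i) =
  gamma_coef v^-1 0 i / kap v i * kap v (a + i) / kap v a.
Proof.
have nk m : kap v m != 0 by apply: kap_neq0 v_neq0 v_expn_neq1.
have vn m : v ^+ m != 0 by rewrite expf_neq0 // v_neq0.
have fE m : v ^- (2 * m) - 1 = v ^- m * (v ^- m - v ^+ m).
  by rewrite mulrBr mulVf // mul2n -addnn exprD invfM.
have -> : vbar (gbinom (a + i)%:Z i) = v ^- (a * i) * (kap v (a + i) / kap v a) / kap v i.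
  rewrite kapD [kap v a * _]mulrC mulfK // /gbinom rmorph_prod /=.
  rewrite big_add1 /= big_mkord /kap.
  have vE (f g : Qv) : vbar ((f - 1) / (g - 1)) = (vbar f - 1) / (vbar g - 1).
    by rewrite fmorph_div /= !rmorphB /= rmorph1.
  rewrite (eq_bigr _ (fun j _ => vE _ _)).
  (* The numerator runs from a+i down to a+1; reversing it matches the order in kap. *)
  rewrite !big_split /= prodfV (reindex_inj rev_ord_inj) /=.
  have -> : \prod_(j < i) (vbar (v ^ (2 * ((a + i)%:Z - (i - j.+1).+1%:Z + 1))) - 1)
     = \prod_(j < i) (v ^- (a + j.+1) * (v ^- (a + j.+1) - v ^+ (a + j.+1))).
    apply: eq_bigr => -[j ltj] _ /=; rewrite -fE; congr (_ - 1).
    have -> : 2 * ((a + i)%:Z - (i - j.+1).+1%:Z + 1) = (2 * (a + j.+1))%:Z.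
      by lia.
    by rewrite -exprnP rmorphXn /= vbar_v exprVn.
  have -> : \prod_(j < i) (vbar (v ^ (2 * j.+1%:Z)) - 1)
     = \prod_(j < i) (v ^- j.+1 * (v ^- j.+1 - v ^+ j.+1)).
    apply: eq_bigr => j _; rewrite -fE; congr (_ - 1).
    by rewrite -PoszM -exprnP rmorphXn /= vbar_v exprVn.
  rewrite !big_split /= -/(kap v i).
  have -> : \prod_(j < i) v ^- (a + j.+1) = v ^- (a * i) * \prod_(j < i) v ^- j.+1.
    have -> : v ^- (a * i) = \prod_(j < i) v ^- a.
      by rewrite prodr_const card_ord -exprVn -exprVn exprM.
    by rewrite -big_split; apply: eq_bigr => j _; rewrite exprD invfM.
  have : \prod_(j < i) v ^- j.+1 != 0.
    by apply/prodf_neq0 => j _; rewrite invr_neq0.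
  move: (nk i); set R := \prod_(k < i) _; move: R (\prod_(j < i) _) (kap v i).
  move: (v ^- (a * i)) => e R w ki ki0 w0.
  by rewrite [e * R]mulrC -[R * e * w]mulrA -mulf_div divff // mul1r.
rewrite gamma_coef_0l; last exact: vV_expn_neq1.
have -> : v ^ ((a * i)%:Z - (i * i.+1 %/ 2)%:Z) = v ^+ (a * i) / v ^+ 'C(i.+1, 2).
  by rewrite bin2 divn2 [(i.+1 * _)%N]mulnC expfzDr ?v_neq0 // exprnN.
rewrite exprVn; move: (vn (a * i)%N).
move: (v ^+ 'C(_, _))^-1 (kap v i)^-1 (kap v a)^-1 (kap v _) (v ^+ (a * i)).
move=> c ki ka K va va0.
by rewrite [va * c]mulrC -!mulrA mulVKf //; congr (_ * _); rewrite [RHS]mulrC mulrA. 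
Qed.

(** Two power series in the index shift compose by the Cauchy product; truncation at N is harmless
    because Y vanishes from N on. *)
Lemma sum_scale_shift (R : pzRingType) (V : lmodType R) (Y : nat -> V)
    (N m : nat) (f g : nat -> R) :
  (forall k, (N <= k)%N -> Y k = 0) ->
  \sum_(i < N) f i *: (\sum_(j < N) g j *: Y (m + i + j)%N) =
  \sum_(n < N) (\sum_(i < n.+1) f i * g (n - i)%N) *: Y (m + n)%N.
Proof.
move=> Y0.
transitivity (\sum_(i < N) \sum_(n < N | (i <= n)%N)
    (f i * g (n - i)%N) *: Y (m + n)%N).
  apply: eq_bigr => -[i lti] _ /=; rewrite scaler_sumr.
  have ltiN : (i <= N)%N by exact: ltnW.
  rewrite -(big_mkord xpredT (fun j => f i *: (g j *: Y (m + i + j)%N))).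
  rewrite (big_cat_nat (n := N - i)) ?leq_subr //=.
  rewrite [X in _ + X]big_nat_cond [X in _ + X]big1 ?addr0; last first.
    move=> j /andP[/andP[le_j _] _]; rewrite Y0 ?scaler0 //.
    by rewrite -addnA (leq_trans _ (leq_addl _ _)) // -leq_subLR.
  rewrite -(big_mkord (fun n => (i <= n)%N)
    (fun n => (f i * g (n - i)%N) *: Y (m + n)%N)).
  rewrite [in RHS](big_cat_nat (n := i)) //=.
  rewrite [X in X + _]big_nat_cond [X in X + _]big1 ?add0r; last first.
    by move=> n /andP[/andP[_ lt_n]]; rewrite leqNgt lt_n.
  rewrite [in RHS](big_addn 0 N i); apply: eq_big => [n|n _]; first by rewrite leq_addl.
  by rewrite addnK scalerA addnAC addnA.
rewrite (exchange_big_dep xpredT) //=; apply: eq_bigr => -[n ltn] _ /=.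
rewrite -scaler_suml; congr (_ *: _).
by rewrite (big_ord_widen N (fun i => f i * g (n - i)%N)).
Qed.

(** * The bar involution in the rescaled basis *)

Section Bar.

Variables (d : nat) (S : falgType Qv) (X : d.+1.-tuple S).
Hypothesis basisX : basis_of fullv X.

Let K := kap v.
Let nzK m : K m != 0. Proof. exact: kap_neq0 v_neq0 v_expn_neq1. Qed.

Let Y m : S := K m *: X`_m.
(** With q = v^2, [rho] lists the coefficients of (1 + t)/(t^2;q^2)_oo, and [mu i] is 1/(q;q)_i, the
    coefficient of t^i in 1/(t;q)_oo. *)
Let rho j : Qv := (qpoch (v ^+ 4) (v ^+ 4) j./2)^-1.
Let mu i : Qv := gamma_coef v^-1 0 i / K i.

Lemma nth_basis_default m : (d < m)%N -> X`_m = 0.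
Proof. by move=> ltdm; rewrite nth_default // size_tuple. Qed.

Let Y_gt m : (d < m)%N -> Y m = 0.
Proof. by move=> ltdm; rewrite /Y nth_basis_default // scaler0. Qed.

(** The default value 0 of [nth] past d lets every sum run over the fixed range [d.+1], whatever the
    starting index. *)
Lemma sum_basis_trunc m (f : nat -> Qv) : (m <= d)%N ->
  \sum_(i < d.+1) f i *: X`_(m + i) =
  f 0 *: X`_m + \sum_(1 <= i < (d - m).+1) f i *: X`_(m + i).
Proof.
move=> le_md; rewrite big_ord_recl addn0 /=; congr (_ + _).
rewrite big_add1 /= -(big_mkord xpredT (fun i => f i.+1 *: X`_(m + i.+1))).
rewrite (big_cat_nat (n := d - m)) ?leq_subr //=.
rewrite [X in _ + X]big_nat_cond [X in _ + X]big1 ?addr0 //.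
move=> j /andP[/andP[le_j _] _]; rewrite nth_basis_default ?scaler0 //.
by rewrite addnS ltnS -leq_subLR.
Qed.

Lemma bar_sum (I : Type) (r : seq I) (f : I -> Qv) (Z : I -> S) :
  bar X (\sum_(i <- r) f i *: Z i) = \sum_(i <- r) vbar (f i) *: bar X (Z i).
Proof.
elim/big_rec2: _ => [|i y z _ <-].
  by have := bar_is_zmod_morphism X 0 0; rewrite !subrr.
have barN w : bar X (- w) = - bar X w.
  have := bar_is_zmod_morphism X 0 w; rewrite sub0r => ->.
  by have := bar_is_zmod_morphism X 0 0; rewrite !subrr => ->; rewrite sub0r.
by rewrite -[z]opprK bar_is_zmod_morphism bar_semilinear barN !opprK.
Qed.

Lemma scaled_monomial m : (m <= d)%N ->
  K m *: monomial X m (d - m) = \sum_(i < d.+1) mu i *: Y (m + i).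
Proof.
move=> le_md; rewrite /monomial.
have E i : mu i *: Y (m + i) =
  (mu i * K (m + i)) *: X`_(m + i) by rewrite scalerA.
under [RHS]eq_bigr do rewrite E.
rewrite (sum_basis_trunc (fun i => mu i * K (m + i)%N)) // scalerDr addn0.
rewrite /mu gamma_coef0 /K kap0 divr1 mul1r; congr (_ + _).
rewrite scaler_sumr; apply: eq_bigr => i _; rewrite scalerA; congr (_ *: _).
by rewrite monomial_coefE mulrC mulfVK.
Qed.

(** The coefficients of (-tq;q)_oo; multiplied by the series of [rho] this gives the series of
    [mu]. *)
Let mu' i : Qv := gamma_coef v 0 i / K i.

Let vbar_mu i : vbar (mu i) = (-1) ^+ i * mu' i.
Proof.
rewrite /mu fmorph_div /= vbar_gamma_coef vbar_kap invfM mulrCA.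
by rewrite -exprVn invrN1.
Qed.

Let conv a n :
  \sum_(i < n.+1) gamma_coef v a i / K (a + i) * rho (n - i) =
  gamma_coef v^-1 a n / K (a + n).
Proof. exact: (gamma_coef_conv a v_neq0 v_expn_neq1). Qed.

(** Downward induction on m: bar is applied to the expansion of the invariant monomial at m, and the
    resulting equation is solved for the leading term. *)
Lemma bar_scaled_basis m :
  bar X (Y m) = (-1) ^+ m *: \sum_(j < d.+1) rho j *: Y (m + j).
Proof.
have [k] := ubnP (d.+1 - m); elim: k m => // k IH m le_k.
have [le_md|lt_dm] := leqP m d; last first.
  rewrite big1 ?scaler0 => [|j _]; last by rewrite Y_gt ?scaler0 // ltn_addr.
  by rewrite Y_gt //; have := bar_is_zmod_morphism X 0 0; rewrite !subrr.
have := congr1 (bar X) (scaled_monomial le_md).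
rewrite bar_semilinear bar_monomial // vbar_kap -scalerA scaled_monomial //.
rewrite bar_sum [X in _ = X -> _]big_ord_recl addn0 /=.
have -> : vbar (mu 0) = 1.
  by rewrite /mu gamma_coef0 /K kap0 divr1 rmorph1.
rewrite scale1r => /esym/(canRL (addrK _)) ->.
(* The factorization of [mu] as [mu'] times [rho] is the convolution identity at a = 0. *)
have -> : \sum_(i < d.+1) mu i *: Y (m + i) =
    \sum_(i < d.+1) mu' i *: \sum_(j < d.+1) rho j *: Y (m + i + j).
  rewrite (@sum_scale_shift _ _ Y d.+1 m mu' rho) //.
  by apply: eq_bigr => n _; rewrite -[mu n](conv 0 n).
rewrite big_ord_recl addn0 {1}/mu' gamma_coef0 /K kap0 divr1 scale1r scalerDr.
rewrite -[LHS]addrA -[RHS]addr0; congr (_ + _); apply/eqP; rewrite subr_eq0.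
rewrite scaler_sumr; apply/eqP/eq_bigr => i _.
(* The induction hypothesis applies at m+i+1; the signs (-1)^(i+1) and (-1)^(m+i+1) combine to
   (-1)^m. *)
rewrite /= /bump /= add1n vbar_mu IH; last by lia.
rewrite !scalerA; congr (_ *: _); rewrite mulrAC -exprD; congr (_ * _).
by rewrite addnC -addnA exprD -[in LHS]signr_odd -[(-1) ^+ (_ + _)]signr_odd addnn odd_double mulr1 signr_odd.
Qed.

Lemma bar_sum_basis a (g : nat -> Qv) :
  bar X (\sum_(i < d.+1) g i *: X`_(a + i)) =
  \sum_(n < d.+1) (K (a + n) *
     \sum_(i < n.+1) vbar (g i) / K (a + i) * rho (n - i)) *: X`_(a + n).
Proof.
have -> : \sum_(i < d.+1) g i *: X`_(a + i) =
    \sum_(i < d.+1) (g i / K (a + i)) *: Y (a + i).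
  by apply: eq_bigr => i _; rewrite scalerA mulfVK.
rewrite bar_sum.
transitivity (\sum_(i < d.+1) (vbar (g i) / K (a + i)) *:
    \sum_(j < d.+1) rho j *: Y (a + i + j)).
  apply: eq_bigr => i _; rewrite bar_scaled_basis scalerA; congr (_ *: _).
  (* The sign (-1)^(a+i) from conjugating kap cancels the one in the image of Y. *)
  rewrite fmorph_div /= vbar_kap invfM -exprVn invrN1 [(-1) ^+ _ * _]mulrC.
  by rewrite -!mulrA -expr2 sqrr_sign mulr1.
rewrite (@sum_scale_shift _ _ Y d.+1 a (fun i => vbar (g i) / K (a + i)%N) rho) //.
by apply: eq_bigr => n _; rewrite scalerA mulrC.
Qed.

End Bar.

(** * Integrality, and bar-fixed scalars *)

(** Integrality follows from the Pascal rule for Gaussian binomials by double induction. *)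
Lemma qbin_intP (F : fieldType) (Q : F) b s : (forall k, Q ^+ k.+1 != 1) ->
  exists p : {poly int}, qbin Q b s = (map_poly intr p).[Q].
Proof.
move=> hQ.
have nQ k : 1 - Q ^+ k.+1 != 0 by rewrite subr_eq0 eq_sym.
have qbinSl c n : qbin Q c.+1 n * (1 - Q ^+ c.+1) = qbin Q c n * (1 - Q ^+ (c + n.+1)).
  elim: n => [|n IHn]; first by rewrite !qbin0 !mul1r addn1.
  by rewrite !qbinS mulrAC IHn addSn -addnS -!mulrA; congr (_ * _); rewrite mulrCA mulrC -mulrA.
have qbin_pascal c n :
    qbin Q c.+1 n.+1 = qbin Q c n.+1 + Q ^+ c.+1 * qbin Q c.+1 n.
  rewrite !qbinS !mulrA -(qbinSl c n); apply: (mulIf (nQ n)).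
  rewrite [RHS]mulrDl !mulfVK // exprD.
  by move: (qbin _ _ _) (Q ^+ c.+1) (Q ^+ n.+1) => B q r; ring.
elim: b s => [|b IHb] s.
  exists 1; rewrite rmorph1 hornerC /qbin big1 // => i _.
  by rewrite add0n divff.
elim: s => [|s [p Ep]]; first by exists 1; rewrite rmorph1 hornerC qbin0.
have [q Eq] := IHb s.+1; exists (q + 'X^(b.+1) * p).
rewrite qbin_pascal Ep Eq rmorphD rmorphM /= hornerD hornerM map_polyXn.
by rewrite hornerXn.
Qed.

Lemma in_vinvZB f g : in_vinvZ f -> in_vinvZ g -> in_vinvZ (f - g).
Proof.
move=> [p ->] [q ->]; exists (p - q).
by rewrite rmorphB hornerD hornerN mulrBr.
Qed.

Lemma vbar_fixed_vinvZ f : vbar f = f -> in_vinvZ f -> f = 0.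
Proof.
move=> fixf [p Ef].
have vbar_intr (q : {poly int}) : vbar (map_poly intr q).[v^-1] = tofrac (map_poly intr q).
  rewrite -[RHS]vbar_pbar /pbar -map_poly_comp; congr (vbar _.[_]).
  by apply: eq_map_poly => z /=; rewrite rmorph_int.
have {}Ef : f = tofrac ('X * map_poly intr p).
  by rewrite -fixf Ef rmorphM fmorphV /= vbar_v invrK vbar_intr rmorphM.
move: fixf; rewrite {}Ef; set P := 'X * _.
rewrite vbar_tofrac => fixP.
have [->|P0] := eqVneq P 0; first by rewrite raddf0.
pose n := (size P).-1.
have szP : size P = n.+1 by rewrite /n prednK // lt0n size_poly_eq0.
have P00 : P`_0 = 0 by rewrite coefXM.
(* With n the degree of P, multiplying P(v^-1) = P by v^n produces the reversal of P. Its degree is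
   below n as P has no constant term, while P X^n has degree 2n. *)
have E : tofrac (P * 'X^n) = tofrac (\sum_(i < n.+1) P`_i *: 'X^(n - i)).
  rewrite rmorphM rmorphXn /= -/v -fixP /pbar horner_coef size_map_poly szP.
  rewrite mulr_suml rmorph_sum; apply: eq_bigr => i _.
  rewrite coef_map -mul_polyC rmorphM rmorphXn /= -mulrA -/v; congr (_ * _).
  have le_in : (i <= n)%N by rewrite -ltnS.
  have -> : v ^+ n = v ^+ i * v ^+ (n - i) by rewrite -exprD subnKC.
  by rewrite mulrA -exprMn mulVf ?v_neq0 // expr1n mul1r.
move/eqP: E; rewrite tofrac_eq => /eqP E.
have : (size (P * 'X^n)%R <= n)%N.
  rewrite E; apply/leq_sizeP => j le_nj; rewrite coef_sum big1 // => i _.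
  rewrite coefZ coefXn; case: eqP => [ji|]; last by rewrite mulr0.
  have -> : (i : nat) = 0%N by move: (ltn_ord i) ji; lia.
  by rewrite P00 mul0r.
by rewrite size_mulXn // szP addnS ltnNge leq_addr.
Qed.

Lemma gamma_coefV_vinvZ a n : (0 < n)%N -> in_vinvZ (gamma_coef v^-1 a n).
Proof.
move=> n0; rewrite /gamma_coef.
have hQ k : (v^-1 ^+ 4) ^+ k.+1 != 1 by rewrite -exprM mulnS vV_expn_neq1.
have [p ->] := qbin_intP (uphalf a) n./2 hQ.
have : (0 < gamma_exp a n)%N.
  rewrite /gamma_exp addn_gt0 muln_gt0; case: (boolP (odd n)) => [_|en] /=.
    by rewrite addn_gt0 n0 !orbT.
  by rewrite bin_gt0 orbF; lia.
(* Removing the factor v^-1 from the positive power leaves v^-e; the binomial is an integer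
   polynomial in v^-4. *)
case: gamma_exp => // e _; exists ('X^e * (p \Po 'X^4)).
rewrite rmorphM /= map_polyXn hornerM hornerXn exprS -!mulrA.
by rewrite map_comp_poly map_polyXn horner_comp hornerXn.
Qed.

(** * The canonical basis element and its coordinates *)

Lemma coord_sum_basis a r (S : falgType Qv) (X : (a + r).+1.-tuple S)
    (f : nat -> Qv) n : basis_of fullv X -> (n <= r)%N ->
  coord X (inord (a + n)) (\sum_(i < (a + r).+1) f i *: X`_(a + i)) = f n.
Proof.
move=> bX le_nr.
have ltn : (n < (a + r).+1)%N by rewrite ltnS (leq_trans le_nr) ?leq_addl.
have val_o m : (m <= r)%N -> (inord (a + m) : 'I_(a + r).+1) = (a + m)%N :> nat.
  by move=> le_mr; rewrite inordK // ltnS leq_add2l.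
have coordX m : (m <= r)%N -> coord X (inord (a + n)) X`_(a + m) = (m == n)%:R.
  move=> le_mr; rewrite -[in X in coord _ _ X](val_o m le_mr).
  rewrite coord_free ?(basis_free bX) //.
  by rewrite -val_eqE /= !val_o // eqn_add2l.
rewrite linear_sum (bigD1 (Ordinal ltn)) //= big1 => [|i ne_in].
  by rewrite linearZ /= coordX // eqxx mulr1 addr0.
rewrite linearZ /=; have [le_ir|lt_ri] := leqP i r; last first.
  by rewrite nth_basis_default ?raddf0 ?mulr0 // ltn_add2l.
by move: ne_in; rewrite coordX // -val_eqE /= => /negPf->; rewrite mulr0.
Qed.

Lemma canonicalE a r (S : falgType Qv) (X : (a + r).+1.-tuple S) :
  basis_of fullv X ->
  canonical X a r = \sum_(i < (a + r).+1) gamma_coef v^-1 a i *: X`_(a + i).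
Proof.
move=> bX; set C := \sum_(i < _) _.
have trunc (g : nat -> Qv) : \sum_(i < (a + r).+1) g i *: X`_(a + i) =
    g 0 *: X`_a + \sum_(1 <= i < r.+1) g i *: X`_(a + i).
  by rewrite sum_basis_trunc ?leq_addr // addKn.
have nzK m : kap v m != 0 by exact: kap_neq0 v_neq0 v_expn_neq1.
have barC : bar X C = C.
  rewrite (bar_sum_basis bX); apply: eq_bigr => n _; congr (_ *: _).
  under eq_bigr do rewrite vbar_gamma_coef.
  by rewrite (gamma_coef_conv a v_neq0 v_expn_neq1) mulrC mulfVK.
have canC : is_canonical X a r C.
  split=> //; exists (gamma_coef v^-1 a); split=> [i /andP[i0 _]|].
    exact: gamma_coefV_vinvZ.
  by rewrite /C trunc gamma_coef0 scale1r.
(* It remains to prove that every canonical x equals C. *)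
apply: (classical_sets.xget_unique _ canC) => x [barx [g [gZ Ex]]].
pose h (i : nat) : Qv := if i == 0%N then 1 else g i.
have {}Ex : x = \sum_(i < (a + r).+1) h i *: X`_(a + i).
  rewrite trunc /h eqxx scale1r Ex; congr (_ + _).
  by rewrite !big_add1; apply: eq_bigr.
have fixD : bar X (x - C) = x - C by rewrite bar_is_zmod_morphism barx barC.
pose f (i : nat) : Qv := h i - gamma_coef v^-1 a i.
have ED : x - C = \sum_(i < (a + r).+1) f i *: X`_(a + i).
  by rewrite Ex -sumrB; apply: eq_bigr => i _; rewrite scalerBl.
(* [c n] is the n-th coefficient of the bar image of x - C, so invariance gives f n = c n. *)
pose c n := kap v (a + n) * \sum_(i < n.+1) vbar (f i) / kap v (a + i) /
  qpoch (v ^+ 4) (v ^+ 4) (n - i)./2.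
have f_eq n : (n <= r)%N -> f n = c n.
  move=> le_nr; rewrite -(coord_sum_basis f bX le_nr) -ED -fixD ED.
  by rewrite bar_sum_basis //; exact: (coord_sum_basis c bX le_nr).
have f0 n : (n <= r)%N -> f n = 0.
  elim/ltn_ind: n => n IHn le_nr.
  apply: vbar_fixed_vinvZ; last first.
    rewrite /f /h; case: n {IHn} le_nr => [_|n le_nr].
      by rewrite gamma_coef0 subrr; exists 0; rewrite rmorph0 horner0 mulr0.
    by apply: in_vinvZB; [exact: gZ | exact: gamma_coefV_vinvZ].
  (* The earlier coefficients vanish, so c n reduces to its last term, the conjugate of f n; hence f
     n is bar-fixed. *)
  rewrite [RHS]f_eq // /c big_ord_recr big1 /= => [|i _]; last first.
    by rewrite IHn ?ltn_ord // ?rmorph0 ?mul0r // ltnW // (leq_trans (ltn_ord i)).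
  by rewrite add0r subnn qpoch0 divr1 mulrC mulfVK.
apply/eqP; rewrite -subr_eq0 ED; apply/eqP; rewrite big1 // => i _.
have [le_ir|lt_ri] := leqP i r; first by rewrite f0 // scale0r.
by rewrite nth_basis_default ?scaler0 // ltn_add2l.
Qed.

Lemma gammaE a r i (S : falgType Qv) (X : (a + r).+1.-tuple S) :
  basis_of fullv X -> (i <= r)%N -> gamma X a r i = gamma_coef v^-1 a i.
Proof.
move=> bX le_ir; rewrite /gamma canonicalE //.
exact: (coord_sum_basis (gamma_coef v^-1 a)).
Qed.

(** * The four explicit formulas *)

Theorem theorem7p6 (a s r : nat) (S : falgType Qv) (X : (a + r).+1.-tuple S)
    (hS : is_ischur X) :
  (~~ odd a ->
    ((2 * s <= r)%N ->
      gamma X a r (2 * s) =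
        v ^ (- 2 * s%:Z ^+ 2 - s%:Z) *
        \prod_(1 <= k < s.+1)
          ((1 - v ^ (- 2 * a%:Z - 4 * k%:Z)) / (1 - v ^ (- 4 * k%:Z)))) /\
    ((2 * s + 1 <= r)%N ->
      gamma X a r (2 * s + 1) =
        v ^ (- a%:Z - 2 * s%:Z ^+ 2 - 3 * s%:Z - 1) *
        \prod_(1 <= k < s.+1)
          ((1 - v ^ (- 2 * a%:Z - 4 * k%:Z)) / (1 - v ^ (- 4 * k%:Z))))) /\
  (odd a ->
    ((2 * s <= r)%N ->
      gamma X a r (2 * s) =
        v ^ (- 2 * s%:Z ^+ 2 + s%:Z) *
        \prod_(1 <= k < s.+1)
          ((1 - v ^ (- 2 * a%:Z - 4 * k%:Z - 2)) / (1 - v ^ (- 4 * k%:Z)))) /\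
    ((2 * s + 1 <= r)%N ->
      gamma X a r (2 * s + 1) =
        v ^ (- a%:Z - 2 * s%:Z ^+ 2 - s%:Z - 1) *
        \prod_(1 <= k < s.+1)
          ((1 - v ^ (- 2 * a%:Z - 4 * k%:Z - 2)) / (1 - v ^ (- 4 * k%:Z))))).
Proof.
have bX : basis_of fullv X by case: hS.
have vN (z : int) (n : nat) : z = - n%:Z -> v ^ z = v^-1 ^+ n.
  by move=> ->; rewrite -exprnN exprVn.
(* All four cases share this shape, leaving only the exponents e and b k to be compared. *)
have gE (b : nat -> int) e n : (n <= r)%N -> n./2 = s -> e = - (gamma_exp a n)%:Z ->
    (forall k, b k = - (4 * (uphalf a + k))%:Z) ->
    gamma X a r n = v ^ e * \prod_(1 <= k < s.+1)
      ((1 - v ^ b k) / (1 - v ^ (- 4 * k%:Z))).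
  move=> le_nr n2 -> eb; rewrite gammaE // /gamma_coef -(vN _ _ erefl) n2.
  congr (_ * _); rewrite big_add1 big_mkord; apply: eq_bigr => k _.
  rewrite -!exprM -(vN _ _ (eb _)) -(vN (- 4 * k.+1%:Z)) //.
  by rewrite PoszM mulNr.
have s2 := odd_double_half a.
have d0 : (2 * s)./2 = s by rewrite mul2n doubleK.
have d1 : (2 * s + 1)./2 = s by rewrite mul2n addn1 /= uphalf_double.
(* Evaluating the binomials for both parities of a reduces the exponents to integer arithmetic. *)
have b0 : ('C(s.*2 + 0, 2) + s = 2 * (s * s))%N.
  rewrite addn0 bin2 -doubleMl doubleK.
  by case: (s) => // m; rewrite doubleS /= -mulnSr -mul2n mulnCA mulnS; lia.
have b1 : ('C(s.*2 + 1, 2) = 'C(s.*2 + 0, 2) + s.*2)%N.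
  by rewrite addn0 addn1 binS bin1.
have o0 : odd (2 * s) = false by rewrite mul2n odd_double.
have o1 : odd (2 * s + 1) by rewrite mul2n addn1 /= odd_double.
split=> [/negPf oa|oa]; split=> le_r;
  apply: gE => // [|k]; rewrite ?uphalf_half /gamma_exp ?d0 ?d1 ?o0 ?o1 oa /=.
all: by rewrite ?expr2; lia.
Qed.
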